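(* Let $a,c>0$, let $b,d$ be real numbers, let $\alpha=\max\{-b/a,-d/c\}$ and $I=(\alpha,\infty)$, and define $$f(x)=\log\left(\frac{\Gamma(ax+b)}{\Gamma(cx+d)}\right)\qquad(x\in I).$$ Then $f$ is completely monotone in $I$ if and only if $a=c$ and $b=d$.
   Context: A function $f:I\to\mathbb{R}$ on an interval $I\subseteq\mathbb{R}$ is called completely monotone if it has derivatives of all orders and $(-1)^n f^{(n)}(x)\ge 0$ for all $n=0,1,2,\ldots$ and all $x\in I$. $\Gamma$ is the Gamma function. *)

(* Defs.v *)
From HB Require Import structures.
From mathcomp Require Import all_boot all_order all_algebra.
From mathcomp Require Import all_classical all_reals all_analysis.
Set Implicit Arguments.
Unset Strict Implicit.
Unset Printing Implicit Defensive.
Import Order.TTheory GRing.Theory Num.Theory.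
Import numFieldNormedType.Exports.
Local Open Scope classical_set_scope.
Local Open Scope ring_scope.

(* Euler's integral, which represents the Gamma function for x > 0 only; for
   x <= 0 the integral diverges and the value here is the default 0. *)
Definition Gamma (R : realType) (x : R) : R :=
  \int[@lebesgue_measure R]_(t in `]0, +oo[) (t `^ (x - 1) * expR (- t)).

(* The derivatives are two-sided, so this is complete monotonicity of the
   restriction of f to I when the interval I is open; the values of f outside I
   are then irrelevant. *)
Definition completely_monotone (R : realType) (I : interval R) (f : R -> R)
    : Prop :=
  forall x : R, x \in I -> forall n : nat,
    derivable (derive1n n f) x 1 /\ 0 <= (-1) ^+ n * derive1n n f x.

(* Main.v *)
Require Import Defs.
From HB Require Import structures.
From mathcomp Require Import all_boot all_order all_algebra.
From mathcomp Require Import all_classical all_reals all_analysis.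
From mathcomp Require Import measurable_realfun ring lra.
Import Order.TTheory GRing.Theory Num.Theory.
Import numFieldNormedType.Exports.
Local Open Scope classical_set_scope.
Local Open Scope ring_scope.

(* Complete monotonicity is only used through f >= 0 and f' <= 0: they confine
   Gamma (a x + b) / Gamma (c x + d) to a compact subinterval of [1, +oo[ as
   x --> +oo.  But if (a, b) <> (c, d), one of the two arguments eventually
   exceeds the other by a fixed s0 > 0, and Gamma (y + s) / Gamma y --> +oo as
   y --> +oo, uniformly in s >= s0; so the ratio tends to +oo or to 0.
   The growth of Gamma comes from t ^ s >= L ^ s on ]L, +oo[, since the mass of
   the integrand on ]0, L] is at most L ^ y, whereas the mass near 2 L is of
   order (2 L) ^ y. *)

Lemma integrable_gamma (R : realType) (y : R) : 1 <= y ->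
  (@lebesgue_measure R).-integrable `]0, +oo[
    (EFin \o (fun t : R => t `^ (y - 1) * expR (- t))).
Proof.
move=> y1.
have i_exp : (@lebesgue_measure R).-integrable `]0, +oo[
    (EFin \o (fun t : R => (2 * (2 * y) `^ (y - 1)) * exponential_pdf 2^-1 t)).
  apply: (@integrableS _ _ _ _ setT) => //.
  under [X in _.-integrable _ X]eq_fun do rewrite /= EFinM.
  by apply: integrableZl => //; apply: integrable_exponential_pdf; lra.
apply: le_integrable i_exp => //.
  apply/measurable_EFinP; apply: measurable_funTS.
  by apply: measurable_funM => //; apply: measurableT_comp.
move=> t /=; rewrite in_itv/= andbT => t0.
rewrite lee_fin exponential_pdfE ?(ltW t0)//.
have y0 : 0 < 2 * y by lra.
pose u := t / (2 * y).
have tE : t = 2 * y * u by rewrite mulrC divfK// gt_eqF.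
have u0 : 0 <= u by rewrite divr_ge0 ?(ltW t0) ?(ltW y0).
rewrite !ger0_norm ?mulr_ge0 ?powR_ge0 ?expR_ge0//.
have -> : expR (- 2^-1 * t) = expR (t / 2) * expR (- t).
  by rewrite -expRD; congr expR; field.
have -> : 2 * (2 * y) `^ (y - 1) * (2^-1 * (expR (t / 2) * expR (- t))) =
    (2 * y) `^ (y - 1) * expR (t / 2) * expR (- t) by field.
rewrite ler_wpM2r ?expR_ge0// [in leLHS]tE powRM ?(ltW y0)//.
rewrite ler_wpM2l ?powR_ge0//.
apply: (@le_trans _ _ (expR u `^ (y - 1))).
  rewrite ge0_ler_powR ?nnegrE ?expR_ge0//; first lra.
  by have := expR_ge1Dx u; lra.
by rewrite -expRM ler_expR tE; nra.
Qed.

Lemma integrable_indic_oc (R : realType) (k a b : R) :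
  (@lebesgue_measure R).-integrable `]0, +oo[
    (EFin \o (fun t : R => k * \1_`]a, b] t)).
Proof.
apply: (@integrableS _ _ _ _ setT) => //.
under [X in _.-integrable _ X]eq_fun do rewrite /= EFinM.
by apply: integrableZl => //; exact: integrable_indic_itv.
Qed.

Lemma Rintegral_indic_oc (R : realType) (k a b : R) : 0 <= a -> a <= b ->
  \int[@lebesgue_measure R]_(t in `]0, +oo[) (k * \1_`]a, b] t) = k * (b - a).
Proof.
move=> a0 ab.
have := integrable_indic_oc R 1 a b.
under [X in _.-integrable _ X]eq_fun do rewrite /= mul1r.
move=> i1; rewrite RintegralZl//; congr (_ * _).
rewrite /Rintegral integral_indic// setIidl; last first.
  by move=> t /=; rewrite !in_itv/= andbT => /andP[/(le_lt_trans a0)].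
rewrite [X in fine X](lebesgue_measure_itv `]a, b])/= lte_fin.
case: ltgtP ab => //= -> _.
by rewrite subrr.
Qed.

(** Only the mass on []m, m + 1]] is kept; there each factor of the integrand is bounded below by
    its value at one endpoint. *)
Lemma ge_Gamma (R : realType) (m y : R) : 0 <= m -> 1 <= y ->
  m `^ (y - 1) * expR (- (m + 1)) <= Gamma y.
Proof.
move=> m0 y1; rewrite -[leLHS]mulr1.
have -> : m `^ (y - 1) * expR (- (m + 1)) * 1 =
    m `^ (y - 1) * expR (- (m + 1)) * (m + 1 - m) by congr (_ * _); lra.
rewrite -Rintegral_indic_oc//; last lra.
apply: le_Rintegral => //; [exact: integrable_indic_oc|exact: integrable_gamma|].
move=> t /=; rewrite in_itv/= andbT => t0.
rewrite indicE mem_setE in_itv/=; case: (boolP (m < t <= m + 1)) => [|_]; last first.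
  by rewrite mulr0 mulr_ge0 ?powR_ge0 ?expR_ge0.
move=> /andP[mt tm]; rewrite mulr1 ler_pM ?powR_ge0 ?expR_ge0//.
  by rewrite ge0_ler_powR ?nnegrE//; lra.
by rewrite ler_expR; lra.
Qed.

Lemma Gamma_gt0 (R : realType) (y : R) : 1 <= y -> 0 < Gamma y.
Proof.
move=> y1; apply: lt_le_trans (ge_Gamma R 1 y ler01 y1).
by rewrite mulr_gt0 ?powR_gt0 ?expR_gt0.
Qed.

Lemma GammaD_ge (R : realType) (L y s : R) : 0 < L -> 1 <= y -> 0 <= s ->
  L `^ s * (Gamma y - L `^ y) <= Gamma (y + s).
Proof.
move=> L0 y1 s0.
have -> : L `^ y = \int[@lebesgue_measure R]_(t in `]0, +oo[)
    (L `^ (y - 1) * \1_`]0, L] t).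
  rewrite Rintegral_indic_oc ?(ltW L0)// subr0 mulrC mulr_powRB1 ?(ltW L0)//.
  by lra.
rewrite /Gamma -RintegralB//; last 2 first.
- exact: integrable_gamma.
- exact: integrable_indic_oc.
have iB : (@lebesgue_measure R).-integrable `]0, +oo[
    (EFin \o (fun t : R =>
      t `^ (y - 1) * expR (- t) - L `^ (y - 1) * \1_`]0, L] t)).
  under [X in _.-integrable _ X]eq_fun do rewrite /= EFinB.
  by apply: integrableB => //; [exact: integrable_gamma|exact: integrable_indic_oc].
rewrite -RintegralZl//; apply: le_Rintegral => //.
- under [X in _.-integrable _ X]eq_fun do rewrite /= EFinM.
  exact: integrableZl.
- by apply: integrable_gamma; lra.
move=> t /=; rewrite in_itv/= andbT => t0.
have -> : t `^ (y + s - 1) = t `^ s * t `^ (y - 1).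
  by rewrite -powRD ?(gt_eqF t0) ?implybT//; congr powR; lra.
rewrite indicE mem_setE in_itv/= t0/=.
case: (leP t L) => tL; last first.
  rewrite mulr0 subr0 -mulrA ler_wpM2r ?mulr_ge0 ?powR_ge0 ?expR_ge0//.
  by rewrite ge0_ler_powR ?nnegrE ?(ltW tL) ?(ltW L0) ?(ltW t0).
apply: (@le_trans _ _ 0); last by rewrite !mulr_ge0 ?powR_ge0 ?expR_ge0.
rewrite pmulr_rle0 ?powR_gt0// subr_le0 mulr1.
rewrite -[leRHS]mulr1 ler_pM ?powR_ge0 ?expR_ge0 ?expR_le1//; last lra.
by rewrite ge0_ler_powR ?nnegrE ?(ltW L0) ?(ltW t0)//; lra.
Qed.

Lemma GammaD_unbounded (R : realType) (K s0 : R) : 0 < s0 -> 0 < K ->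
  exists2 Y : R, 1 <= Y &
    forall y s, Y <= y -> s0 <= s -> K * Gamma y < Gamma (y + s).
Proof.
move=> s00 K0.
(* Chosen so that [L]^ s0 = 2 * K + 1[; since]L >= 1[, also]L [^ s >= 2 * K + 1] for all
   [s >= s0]. *)
pose L : R := (2 * K + 1) `^ s0^-1.
have L1 : 1 <= L.
  by rewrite -[leLHS](powRr0 (2 * K + 1)) ler_powR ?invr_ge0 ?(ltW s00)//; lra.
have L0 : 0 < L by lra.
have Ls0 : L `^ s0 = 2 * K + 1.
  by rewrite /L -powRrM mulVf ?gt_eqF// powRr1//; lra.
(* [C] is chosen so that [2 * L `^ y <= (2 * L) `^ (y - 1) * expR (- (2 * L + 1))]
   as soon as [C <= 2 `^ (y - 1)]. *)
pose C : R := 2 * L * expR (2 * L + 1).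
have C0 : 0 < C by rewrite !mulr_gt0 ?expR_gt0.
have ln20 : 0 < ln 2 :> R by rewrite ln_gt0//; lra.
exists (1 + `|ln C / ln 2|); first by rewrite lerDl.
move=> y s Yy s0s.
have y1 : 1 <= y by apply: le_trans Yy; rewrite lerDl.
have C2 : C <= 2 `^ (y - 1).
  rewrite -ler_ln ?posrE ?powR_gt0// ln_powR -ler_pdivrMr//.
  by have := ler_norm (ln C / ln 2); lra.
have mass_near_2L : 2 * L `^ y <= Gamma y.
  apply: le_trans (ge_Gamma R (2 * L) y _ y1); last by rewrite mulr_ge0 ?ltW.
  rewrite powRM ?(ltW L0)// -(mulr_powRB1 (ltW L0) (lt_le_trans ltr01 y1)).
  rewrite expRN ler_pdivlMr ?expR_gt0//.
  have -> : 2 * (L * L `^ (y - 1)) * expR (2 * L + 1) = C * L `^ (y - 1).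
    by rewrite /C; ring.
  by rewrite ler_wpM2r ?powR_ge0.
have G0 := Gamma_gt0 R y y1.
have sge0 : 0 <= s by lra.
apply: lt_le_trans (GammaD_ge R L y s L0 y1 sge0).
apply: (@lt_le_trans _ _ ((2 * K + 1) * (Gamma y / 2))).
  by nra.
apply: ler_pM; [lra|lra| |lra].
by rewrite -Ls0 ler_powR.
Qed.

Lemma completely_monotone_bounded (R : realType) (p x0 : R) (f : R -> R) :
  completely_monotone `]p, +oo[ f -> p < x0 ->
  forall x, x0 <= x -> 0 <= f x <= f x0.
Proof.
move=> cm px0 x x0x.
have inI z : x0 <= z -> z \in `]p, +oo[.
  by move=> x0z; rewrite in_itv/= andbT (lt_le_trans px0).
have [_] := cm x (inI _ x0x) 0%N; rewrite /= expr0 mul1r => -> /=.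
apply: (@ler0_derive1_nincry R f x0) => // [z|z|].
- rewrite in_itv/= andbT => /ltW/inI zI.
  by have [] := cm z zI 0%N.
- rewrite in_itv/= andbT => /ltW/inI zI.
  by have [_] := cm z zI 1%N; rewrite /= expr1 mulN1r oppr_ge0.
- apply: derivable_within_continuous => z; rewrite in_itv/= andbT => /inI zI.
  by have [] := cm z zI 0%N.
Qed.

Lemma affine_gap (R : realType) (a b c d : R) :
  c < a \/ (a = c /\ d < b) ->
  exists s X : R, 0 < s /\ forall x, X <= x -> s <= (a * x + b) - (c * x + d).
Proof.
case=> [ca|[-> db]]; last first.
  by exists (b - d), 0; split => [|x _]; lra.
(* With distinct slopes the gap increases in [x], and it equals 1 at this abscissa. *)
exists 1, ((1 + d - b) / (a - c)); split => // x.
by rewrite ler_pdivrMr; lra.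
Qed.

Lemma Gamma_affine_unbounded (R : realType) (K a b c d : R) :
  0 < K -> 0 < c -> c < a \/ (a = c /\ d < b) ->
  exists X : R, forall x, X <= x ->
    [/\ 1 <= a * x + b, 1 <= c * x + d &
       K * Gamma (c * x + d) < Gamma (a * x + b)].
Proof.
move=> K0 c0 /affine_gap[s [X [s0 gap]]].
have [Y Y1 growth] := GammaD_unbounded R K s s0 K0.
exists (Num.max X ((Y - d) / c)) => x; rewrite ge_max => /andP[/gap sx].
rewrite ler_pdivrMr// => Yx.
have Yy : Y <= c * x + d by lra.
split; [lra|lra|].
(* The shift is the whole gap, which may vary with [x]; hence the need for a growth bound uniform in
   the shift. *)
by have := growth _ _ Yy sx; rewrite subrKC.
Qed.

Theorem theorem2p16 (R : realType) (a b c d : R) (ha : 0 < a) (hc : 0 < c) :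
  let alpha := Num.max (- b / a) (- d / c) in
  let f := fun x : R => ln (Gamma (a * x + b) / Gamma (c * x + d)) in
  completely_monotone `]alpha, +oo[ f <-> (a = c /\ b = d).
Proof.
move=> alpha f; split => [cm|[ac bd]]; last first.
  (* The equality holds on all of R, so that it passes to derivatives: where [Gamma (c * x + d)] is
     0, the conventions for division by 0 and [ln 0] still give 0. *)
  have f0 : f = cst 0.
    apply/funext => x; rewrite /f ac bd /=.
    have [->|g0] := eqVneq (Gamma (c * x + d)) 0; first by rewrite mul0r ln0.
    by rewrite divff// ln1.
  have fn0 n : derive1n n f = cst 0.
    elim: n => [//|n IHn]; rewrite derive1nS IHn.
    by apply/funext => x; exact: derive1_cst.
  by move=> x _ n; rewrite fn0 mulr0; split => //; exact: derivable_cst.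
pose x0 := alpha + 1.
have ax0 : alpha < x0 by rewrite ltrDl.
have bnd := completely_monotone_bounded R alpha x0 f cm ax0.
(* With [K = expR (f x0)], the ratio of Gammas would exceed [expR (f x0)] far out, against
   [f x <= f x0]. *)
have no_gt : ~ (c < a \/ (a = c /\ d < b)).
  move=> /(Gamma_affine_unbounded R (expR (f x0)) a b c d (expR_gt0 _) hc)[X].
  pose x := Num.max X x0 => /(_ x); rewrite le_max lexx => /(_ isT)[y1 z1].
  have /bnd/andP[_] : x0 <= x by rewrite le_max lexx orbT.
  rewrite -ler_expR {1}/f lnK ?posrE ?divr_gt0 ?Gamma_gt0//.
  by rewrite ler_pdivrMr ?Gamma_gt0// leNgt => /negP.
(* With the roles exchanged, [K = 1] suffices: the ratio would drop below 1, against [0 <= f x]. *)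
have no_lt : ~ (a < c \/ (c = a /\ b < d)).
  move=> /(Gamma_affine_unbounded R 1 c d a b ltr01 ha)[X].
  pose x := Num.max X x0 => /(_ x); rewrite le_max lexx => /(_ isT)[y1 z1].
  have /bnd/andP[+ _] : x0 <= x by rewrite le_max lexx orbT.
  rewrite -ler_expR expR0 /f lnK ?posrE ?divr_gt0 ?Gamma_gt0//.
  by rewrite ler_pdivlMr ?Gamma_gt0// !mul1r leNgt => /negP.
have [ac|ca|ac] := ltgtP a c.
- by case: no_lt; left.
- by case: no_gt; left.
split => //; have [bd|db|//] := ltgtP b d.
- by case: no_lt; right.
- by case: no_gt; right.
Qed.
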